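(* There exist absolute constants $c, C>0$ such that for every positive integer $N$, \[ c N^{10} \le \mathfrak{C}_3(N) \le C N^{10}. \]
   Context: For positive integers $d,N$, let $\mathrm{Mat}_d(\mathbb{Z},N)$ denote the set of $d\times d$ matrices with all entries in $[-N,N]\cap\mathbb{Z}$, and let $\mathfrak{C}_d(N)$ be the number of pairs $(A,B)\in \mathrm{Mat}_d(\mathbb{Z},N)^2$ with $AB=BA$. *)

(* Defs.v *)
From mathcomp Require Import all_boot all_order all_algebra.
Set Implicit Arguments. Unset Strict Implicit. Unset Printing Implicit Defensive.
Import Order.TTheory GRing.Theory Num.Theory.
Local Open Scope ring_scope.

(* An index k : 'I_(2N+1) encodes the integer k - N in [-N, N]. *)
Definition entry_val (N : nat) (k : 'I_(2 * N + 1)) : int := (k%:Z - N%:Z).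

(* Mat_d(Z,N) is in bijection with 'M['I_(2N+1)]_d via entry_val. *)
Definition to_intmx (d N : nat) (A : 'M['I_(2 * N + 1)]_d) : 'M[int]_d :=
  map_mx (@entry_val N) A.

Definition commuting_count (d N : nat) : nat :=
  #|[set AB : 'M['I_(2 * N + 1)]_d * 'M['I_(2 * N + 1)]_d |
      to_intmx AB.1 *m to_intmx AB.2 == to_intmx AB.2 *m to_intmx AB.1]|.

(* Main.v *)
Require Import Defs.
From mathcomp Require Import all_boot all_order all_algebra.
From mathcomp Require Import zify ring.
Set Implicit Arguments. Unset Strict Implicit. Unset Printing Implicit Defensive.
Import Order.TTheory GRing.Theory Num.Theory.
Local Open Scope ring_scope.

(** Scalar matrices B give the lower bound. For the upper bound, subtract scalars so that the last
    diagonal entry vanishes; this costs a factor N^2, and it remains to bound by M^8 the number of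
    commuting pairs (A, B) of such normalized matrices with entries at most M = 2N.

    Either A has a cyclic vector, or A = l + u v with u a column and v a primitive row. In the
    first case the commutant of A is commutative and, modulo scalars, a lattice of rank 2, so it
    contains O((M/|P|)^2) matrices B, where P is its shortest nonzero element. In the second case
    it contains O(M^4) of them.

    Group the cyclic A by P. If P is cyclic, it has the same commutant as A, so there are
    O((M/|P|)^2) such A, and the sum over P in Z^8 of (M/|P|)^4 is O(M^8). If P = l + u v, there
    are O(M^4) such A, and since |u||v| <= 3|P| the sum of (M/|P|)^2 over these P is O(M^4). *)

(** * Cyclic vectors and commutants *)

Lemma scalemx_inj (R : idomainType) (m n : nat) (d : R) :
  d != 0 -> injective (fun X : 'M[R]_(m, n) => d *: X).
Proof.
move=> d0 X Y /matrixP e; apply/matrixP => i j; apply: (mulfI d0).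
by have := e i j; rewrite !mxE.
Qed.

(** The columns are [u], [A u], [A^2 u], so [u] is a cyclic vector over the rationals exactly when
    the determinant is nonzero. *)
Definition krylov (A : 'M[int]_3) (u : 'cV[int]_3) : 'M[int]_3 :=
  \matrix_(i, j) (A ^+ j *m u) i 0.

Lemma krylov_mulmx (A : 'M[int]_3) (u c : 'cV[int]_3) :
  krylov A u *m c = (\sum_(j < 3) c j 0 *: A ^+ j) *m u.
Proof.
apply/matrixP => i k; rewrite !ord1 mulmx_suml summxE !mxE.
by apply: eq_bigr => j _; rewrite -scalemxAl !mxE mulrC.
Qed.

Lemma mulmx_krylov (A Y : 'M[int]_3) (u : 'cV[int]_3) :
  Y *m A = A *m Y -> Y *m u = 0 -> Y *m krylov A u = 0.
Proof.
move=> cYA Yu; apply/matrixP => i k; rewrite !mxE.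
have cYAk : Y * A ^+ k = A ^+ k * Y by apply: commrX.
transitivity ((Y *m (A ^+ k *m u)) i 0).
  by rewrite mxE; apply: eq_bigr => j _; rewrite !mxE.
by rewrite mulmxA [Y *m A ^+ k]cYAk -[(A ^+ k * Y)%R]/(A ^+ k *m Y) -mulmxA Yu mulmx0 mxE.
Qed.

(** A matrix commuting with [A] is determined by its value at the cyclic vector [u]. Cramer's rule
    expands [B u] in [u], [A u], [A^2 u], the determinant clearing denominators, and the same
    polynomial in [A] must then give [B]. *)
Lemma commutant_cyclic (A B : 'M[int]_3) (u : 'cV[int]_3) :
  \det (krylov A u) != 0 -> A *m B = B *m A ->
  exists c : 'I_3 -> int, \det (krylov A u) *: B = \sum_(j < 3) c j *: A ^+ j.
Proof.
set d := \det _ => d0 cAB.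
pose c := \adj (krylov A u) *m (B *m u); exists (c^~ 0).
pose Q := \sum_(j < 3) c j 0 *: A ^+ j; pose Y := d *: B - Q.
have cQA : Q *m A = A *m Q.
  rewrite mulmx_suml mulmx_sumr; apply: eq_bigr => j _.
  rewrite -scalemxAl -scalemxAr; congr (_ *: _).
  exact: (esym (commrX j (commr_refl A))).
have Yu : Y *m u = 0.
  by rewrite mulmxBl -krylov_mulmx mulmxA mul_mx_adj -scalemxAl mul_scalar_mx subrr.
have cYA : Y *m A = A *m Y.
  by rewrite mulmxBl mulmxBr cQA -scalemxAl -scalemxAr cAB.
have YK := mulmx_krylov cYA Yu.
have dY : d *: Y = 0.
  by rewrite -mul_mx_scalar -mul_mx_adj mulmxA YK mul0mx.
apply/eqP; rewrite -subr_eq0; apply/eqP; apply: (scalemx_inj d0).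
by rewrite dY scaler0.
Qed.

(** Up to a nonzero factor, [B] and [C] are both polynomials in [A]. *)
Lemma commutant_cyclic_comm (A B C : 'M[int]_3) (u : 'cV[int]_3) :
  \det (krylov A u) != 0 -> A *m B = B *m A -> A *m C = C *m A ->
  B *m C = C *m B.
Proof.
move=> d0 /(commutant_cyclic d0)[b eb] /(commutant_cyclic d0)[c ec].
have cPQ : GRing.comm (\sum_(j < 3) b j *: A ^+ j) (\sum_(j < 3) c j *: A ^+ j).
  apply: commr_sum => j _; apply: commr_sym; apply: commr_sum => i _.
  rewrite /GRing.comm -!scalerAl -!scalerAr !scalerA [_ * c _]mulrC; congr (_ *: _).
  by rewrite -!exprD addnC.
move: cPQ; rewrite -eb -ec /GRing.comm -!scalerAl -!scalerAr !scalerA.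
by apply: scalemx_inj; rewrite mulf_neq0.
Qed.

(** * Matrices without a cyclic vector *)

Lemma sum_ord3 (V : nmodType) (F : 'I_3 -> V) :
  \sum_(i < 3) F i = F ord0 + F (inord 1) + F ord_max.
Proof.
rewrite !big_ord_recl big_ord0 addr0 addrA; congr (_ + F _ + F _); apply/val_inj => //=.
by rewrite inordK.
Qed.

Lemma ord3P (k : 'I_3) : [\/ k = ord0, k = inord 1 | k = ord_max].
Proof.
by case: k => [[|[|[|//]]] p]; [constructor 1|constructor 2|constructor 3];
  apply/val_inj; rewrite /= ?inordK.
Qed.

Lemma det_mx33 (R : comNzRingType) (M : 'M[R]_3) (o := inord 1 : 'I_3) :
  \det M = M ord0 ord0 * (M o o * M ord_max ord_max - M o ord_max * M ord_max o)
   - M ord0 o * (M o ord0 * M ord_max ord_max - M o ord_max * M ord_max ord0)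
   + M ord0 ord_max * (M o ord0 * M ord_max o - M o o * M ord_max ord0).
Proof.
have l0 : lift ord0 ord0 = o :> 'I_3 by apply/val_inj; rewrite /= inordK.
have l0' : lift ord0 (lift ord0 ord0) = ord_max :> 'I_3 by apply/val_inj.
have e1 : (ord_max : 'I_2) = lift ord0 ord0 by apply/val_inj.
have l10 : lift o ord0 = ord0 :> 'I_3 by apply/val_inj; rewrite /= inordK.
have l11 : lift o ord_max = ord_max :> 'I_3 by apply/val_inj; rewrite /= inordK.
have l20 : lift ord_max ord0 = ord0 :> 'I_3 by apply/val_inj.
have l21 : lift ord_max ord_max = o :> 'I_3 by apply/val_inj; rewrite /= inordK.
have det2 (N : 'M[R]_2) : \det N = N ord0 ord0 * N ord_max ord_max - N ord0 ord_max * N ord_max ord0.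
  have m0 : lift ord_max ord0 = ord0 :> 'I_2 by apply/val_inj.
  rewrite (expand_det_row _ ord0) !big_ord_recl big_ord0 /cofactor !det_mx11 !mxE -e1 /=.
  rewrite ?m0.
  by rewrite /= ?(addn0, add0n, expr0, expr1, mul1r, mulN1r, addr0) ?mulrN /= .
rewrite (expand_det_row _ ord0) sum_ord3 /cofactor !det2 !mxE.
rewrite l10 l11 l20 l21 -?l0 ?e1 ?l0' -?l0 /= ?inordK //=.
rewrite ?add0n expr0 expr1 sqrrN expr1n -/o -?l0; ring.
Qed.

Lemma det_krylov (A : 'M[int]_3) (u : 'cV[int]_3) (o := inord 1 : 'I_3)
  (w := A *m u) (z := A *m w) :
  \det (krylov A u) = u ord0 0 * (w o 0 * z ord_max 0 - w ord_max 0 * z o 0)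
   - u o 0 * (w ord0 0 * z ord_max 0 - w ord_max 0 * z ord0 0)
   + u ord_max 0 * (w ord0 0 * z o 0 - w o 0 * z ord0 0).
Proof.
have k0 i : krylov A u i ord0 = u i 0 by rewrite mxE expr0 mul1mx.
have k1 i : krylov A u i o = w i 0 by rewrite mxE inordK // expr1.
have k2 i : krylov A u i ord_max = z i 0 by rewrite mxE /= expr2 -mulmxA.
rewrite det_mx33 !k0 !k1 !k2; ring.
Qed.

(** The cubic form [det (u, A u, A^2 u)] at [u = (x, y, z)], for [A] with rows [(a, p, q)],
    [(b, r, s)], [(c, t, w)]. *)
Definition krylov_form (R : comNzRingType) (a p q b r s c t w x y z : R) : R :=
  let x' := a * x + p * y + q * z in
  let y' := b * x + r * y + s * z in
  let z' := c * x + t * y + w * z in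
  let x'' := a * x' + p * y' + q * z' in
  let y'' := b * x' + r * y' + s * z' in
  let z'' := c * x' + t * y' + w * z' in
  x * (y' * z'' - z' * y'') - y * (x' * z'' - z' * x'') + z * (x' * y'' - y' * x'').

(* The value g = w - s c / b is the only one for which the minor of A - g with rows 2, 3 and
   columns 1, 3 vanishes. With it, b f(x, 0, 1) is a product of two factors affine in x, the
   first of them being constant, and the vanishing at three points kills that constant. *)
Lemma derogatory_pivot (F : fieldType) (a p q b r s c t w : F)
    (f := krylov_form a p q b r s c t w) :
  (2 : F) != 0 -> b != 0 ->
  f 1 0 0 = 0 -> f 0 0 1 = 0 -> f 1 0 1 = 0 -> f (-1) 0 1 = 0 ->
  exists g : F,
    [/\ b * p = (a - g) * (r - g), b * q = (a - g) * s,
        b * t = c * (r - g) & b * (w - g) = c * s].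
Proof.
move=> two0 b0 H1 H2 H3 H4; pose k := c / b; pose g := w - s * k.
have ec : c = b * k by rewrite /k; field.
have ew : w = g + s * k by rewrite /g; ring.
have et : t = k * (r - g).
  apply: (mulfI b0); apply: (mulfI b0); apply/eqP; rewrite -subr_eq0 -H1 /f /krylov_form ew ec; apply/eqP; ring.
clearbody k g; subst c w t.
pose h := r - g + s * k; pose m := b * q - (a - g) * s.
have E (x : F) : f x 0 1 = b * (q + x * (a - g)) ^+ 2 + (h - (a - g)) * (q + x * (a - g)) * (s + x * b) - (p + q * k) * (s + x * b) ^+ 2.
  by rewrite /f /krylov_form /h; ring.
(* The second difference of [f x 0 1] at [x = 0] isolates the coefficient of [x^2], which is
   [b ((a - g) h - b (p + q k))]. *)
have E0 : b * (p + q * k) = (a - g) * h.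
  apply: (mulfI b0); apply: (mulfI two0); apply/eqP; rewrite -subr_eq0.
  have <- : f 0 0 1 *+ 2 - f 1 0 1 - f (-1) 0 1 = 0 by rewrite H2 H3 H4 mul0rn !subr0.
  by rewrite !E; apply/eqP; ring.
have F0 (x : F) : f x 0 1 = 0 -> m * (b * q + h * s + x * b * (a - g + h)) = 0.
  move=> fx; transitivity (b * f x 0 1); last by rewrite fx mulr0.
  by rewrite E mulrBr mulrA mulrA [b * (p + _)]E0 /m; ring.
have m0 : m = 0.
  apply/eqP; apply: contraT => m0.
  move: (F0 _ H2) (F0 _ H3) => /eqP; rewrite mulf_eq0 (negPf m0) /= => /eqP K0.
  move=> /eqP; rewrite mulf_eq0 (negPf m0) /= => /eqP K1.
  have : b * (a - g + h) = 0 by move: K0 K1; rewrite mul0r mul0r addr0 => ->; rewrite add0r mul1r.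
  move/eqP; rewrite mulf_eq0 (negPf b0) /= => /eqP K2.
  case/negP: m0; apply/eqP.
  transitivity (b * q + h * s + 0 * b * (a - g + h) - (a - g + h) * s); first by rewrite /m; ring.
  by rewrite K0 K2 mul0r subr0.
have eq : b * q = (a - g) * s by apply/eqP; rewrite -subr_eq0 -/m m0.
exists g; split => //; try by ring.
apply/eqP; rewrite -subr_eq0; apply/eqP.
transitivity (b * (p + q * k) - (a - g) * h - k * (b * q - (a - g) * s)); first by rewrite /h; ring.
by rewrite E0 eq !subrr mulr0 subr0.
Qed.

Lemma rat_root_monic_quadratic (m n : int) (g : rat) :
  g ^+ 2 + m%:~R * g + n%:~R = 0 -> exists k : int, g = k%:~R.
Proof.
move=> e; have d0 : (denq g)%:~R != 0 :> rat by rewrite intr_eq0 denq_neq0.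
have E : numq g ^+ 2 = - denq g * (m * numq g + n * denq g).
  apply/eqP; rewrite -(eqr_int rat) -subr_eq0; apply/eqP.
  transitivity ((g ^+ 2 + m%:~R * g + n%:~R) * (denq g)%:~R ^+ 2); last by rewrite e mul0r.
  have eg : (numq g)%:~R = g * (denq g)%:~R by rewrite -{2}[g]divq_num_den divfK.
  rewrite !(rmorphM, rmorphD, rmorphN, rmorphXn) /= eg; ring.
have : (denq g %| numq g ^+ 2)%Z by rewrite E mulNr -mulrN dvdz_mulr.
have c : coprimez (denq g) (numq g) by rewrite /coprimez gcdzC; exact: coprime_num_den.
rewrite expr2 Gauss_dvdzr // => /dvdzP[q eq].
exists q; rewrite -[g]divq_num_den {1}eq intrM mulfK //.
Qed.

(** The column [x] is a Bézout certificate that the row [v] is primitive; the content of the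
    rank-one part is carried by [u]. *)
Definition derogatory (A : 'M[int]_3) : Prop :=
  exists l (u : 'cV[int]_3) (v : 'rV[int]_3) (x : 'cV[int]_3),
    [/\ A = l%:M + u *m v, u != 0 & v *m x = 1%:M].

(** All rows are proportional to row [i]. Dividing that row by the gcd of its entries gives [v], the
    Bézout coefficients give [x], and [u] is [W x]. *)
Lemma rank_one_factor (W : 'M[int]_3) (i j : 'I_3) :
  W i j != 0 -> (forall l m, W i j * W l m = W l j * W i m) ->
  exists (u : 'cV[int]_3) (v : 'rV[int]_3) (x : 'cV[int]_3),
    [/\ W = u *m v, u != 0 & v *m x = 1%:M].
Proof.
move=> b0 H.
pose h := gcdz (W i ord0) (W i (inord 1)); pose g := gcdz h (W i ord_max).
have gdv m : (g %| W i m)%Z.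
  have gh : (g %| h)%Z by apply: dvdz_gcdl.
  case: (ord3P m) => ->;
    [apply: (dvdz_trans gh); exact: dvdz_gcdl|apply: (dvdz_trans gh); exact: dvdz_gcdr|exact: dvdz_gcdr].
pose v : 'rV[int]_3 := \row_m (W i m %/ g)%Z.
have gv m : W i m = v 0 m * g by rewrite mxE divzK.
have g0 : g != 0 by apply: contraNneq b0 => g0; rewrite gv g0 mulr0.
have [x1 [x2 e1]] := Bezoutz (W i ord0) (W i (inord 1)).
have [y1 [y2 e2]] := Bezoutz h (W i ord_max).
pose x : 'cV[int]_3 := \col_m (if m == ord0 then y1 * x1 else if m == inord 1 then y1 * x2 else y2).
have vx : \sum_m v 0 m * x m 0 = 1.
  have eg : g = y1 * (x1 * W i ord0 + x2 * W i (inord 1)) + y2 * W i ord_max by rewrite e1 e2.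
  apply: (mulIf g0); rewrite mul1r [RHS]eg sum_ord3 !mxE eqxx.
  have -> : (inord 1 == ord0 :> 'I_3) = false by rewrite -val_eqE /= inordK.
  have -> : (ord_max == inord 1 :> 'I_3) = false by rewrite -val_eqE /= inordK.
  rewrite eqxx /= !mulrDl.
  have K m y : (W i m %/ g)%Z * y * g = W i m * y by rewrite mulrAC divzK.
  rewrite !K; ring.
have Wuv : W = (W *m x) *m v.
  apply/matrixP => l m; apply: (mulfI b0); rewrite H [RHS]mulrC mxE big_ord1 mxE.
  rewrite -mulrA [v _ _ * _]mulrC mulrA mulr_suml.
  transitivity (\sum_n v 0 n * x n 0 * (W l j * W i m)); first by rewrite -mulr_suml vx mul1r.
  rewrite mulr_suml; apply: eq_bigr => n _.
  rewrite [W l n * _ * _]mulrAC [W l n * _]mulrC H !gv; ring.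
exists (W *m x), v, x; split => //.
- by apply: contraNneq b0 => u0; rewrite Wuv u0 mul0mx mxE.
- by apply/matrixP => a b; rewrite !ord1 !mxE vx.
Qed.

(** Trying only vectors with entries in {-1, 0, 1} makes the test finite; its failure already forces
    [A] to be scalar or derogatory. *)
Definition cyclicb (A : 'M[int]_3) : bool :=
  [exists u : 'cV['I_(2 * 1 + 1)]_3, \det (krylov A (map_mx (@entry_val 1) u)) != 0].

Lemma entry_val_surj (M : nat) (x : int) :
  (`|x| <= M)%N -> exists k : 'I_(2 * M + 1), entry_val k = x.
Proof.
move=> xM; have h : (`|(x + M%:Z)%R| < 2 * M + 1)%N by lia.
exists (Ordinal h); rewrite /entry_val /=; lia.
Qed.

Lemma noncyclic_form (A : 'M[int]_3) (x y z : int) (o := inord 1 : 'I_3) :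
  ~~ cyclicb A -> (`|x| <= 1)%N -> (`|y| <= 1)%N -> (`|z| <= 1)%N ->
  krylov_form (A ord0 ord0) (A ord0 o) (A ord0 ord_max)
    (A o ord0) (A o o) (A o ord_max)
    (A ord_max ord0) (A ord_max o) (A ord_max ord_max) x y z = 0.
Proof.
move=> nc /(@entry_val_surj 1)[x' ex] /(@entry_val_surj 1)[y' ey] /(@entry_val_surj 1)[z' ez].
pose u : 'cV['I_(2 * 1 + 1)]_3 :=
  \col_i (if i == ord0 then x' else if i == o then y' else z').
move: nc; rewrite negb_exists => /forallP/(_ u); rewrite negbK => /eqP <-.
have o0 : (o == ord0) = false by rewrite -val_eqE /= inordK.
have mo : (ord_max == o :> 'I_3) = false by rewrite -val_eqE /= inordK.
have u0 : map_mx (@entry_val 1) u ord0 0 = x by rewrite !mxE eqxx.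
have u1 : map_mx (@entry_val 1) u o 0 = y by rewrite !mxE o0 eqxx.
have u2 : map_mx (@entry_val 1) u ord_max 0 = z by rewrite !mxE mo.
have mulE (v : 'cV[int]_3) i :
    (A *m v) i 0 = A i ord0 * v ord0 0 + A i o * v o 0 + A i ord_max * v ord_max 0.
  by rewrite mxE sum_ord3.
by rewrite det_krylov -/o !mulE u0 u1 u2.
Qed.

(** With the indices ordered [j], [i], [k], the four equations of [derogatory_pivot] say that the 2
    x 2 minors of [A - g] through the pivot [A i j] vanish, so [A - g] has rank one. It remains to
    see that [g] is an integer. *)
Lemma derogatory_of_pivot (A : 'M[int]_3) (i j k : 'I_3) :
  (forall l, [\/ l = j, l = i | l = k]) -> i != j -> i != k -> j != k ->
  A i j != 0 ->
  (forall x z : int, (`|x| <= 1)%N -> (`|z| <= 1)%N ->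
     krylov_form (A j j) (A j i) (A j k) (A i j) (A i i) (A i k)
       (A k j) (A k i) (A k k) x 0 z = 0) ->
  derogatory A.
Proof.
move=> all3 ij ik jk b0 H.
have HQ (x z : int) : (`|x| <= 1)%N -> (`|z| <= 1)%N ->
   krylov_form (A j j)%:~R (A j i)%:~R (A j k)%:~R (A i j)%:~R (A i i)%:~R (A i k)%:~R
       (A k j)%:~R (A k i)%:~R (A k k)%:~R (x%:~R : rat) 0 z%:~R = 0.
  move=> hx hz; have /(congr1 (intr : int -> rat)) := H _ _ hx hz.
  move=> e; apply: etrans e; rewrite /krylov_form /= !(rmorphD, rmorphB, rmorphM) /=; ring.
have b0' : (A i j)%:~R != 0 :> rat by rewrite intr_eq0.
have two0 : (2 : rat) != 0 by [].
have [||||g [e1 e2 e3 e4]] := derogatory_pivot two0 b0' (p := (A j i)%:~R) (a := (A j j)%:~R)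
  (q := (A j k)%:~R) (r := (A i i)%:~R) (s := (A i k)%:~R) (c := (A k j)%:~R) (t := (A k i)%:~R) (w := (A k k)%:~R).
- exact: (HQ 1 0).
- exact: (HQ 0 1).
- exact: (HQ 1 1).
- exact: (HQ (-1) 1).
(* By [e1], [g] is an eigenvalue of the 2 x 2 block on [j], [i], hence a root of a monic integer
   quadratic. *)
have [l el] : exists l : int, g = l%:~R.
  apply: (@rat_root_monic_quadratic (- (A j j + A i i)) (A j j * A i i - A i j * A j i)).
  rewrite !(rmorphD, rmorphB, rmorphN, rmorphM) /= e1; ring.
have toZ (x y : int) : x%:~R = y%:~R :> rat -> x = y by move/eqP; rewrite eqr_int => /eqP.
move: e1 e2 e3 e4; rewrite el -!rmorphB -!rmorphM => /toZ e1 /toZ e2 /toZ e3 /toZ e4.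
pose W := A - l%:M.
have Wd n : W n n = A n n - l by rewrite !mxE eqxx mulr1n.
have Wo m n : m != n -> W m n = A m n by move=> /negPf mn; rewrite !mxE mn mulr0n subr0.
have ji : j != i by rewrite eq_sym.
have ki : k != i by rewrite eq_sym.
have kj : k != j by rewrite eq_sym.
have Wij : W i j = A i j by rewrite Wo.
have [||u [v [x [eW u0 vx]]]] := @rank_one_factor W i j.
- by rewrite Wij.
- move=> m n; case: (all3 m) => ->; case: (all3 n) => ->; rewrite ?Wd ?Wo //; try (by rewrite mulrC); lia.
exists l, u, v, x; split => //.
by rewrite -eW /W addrC subrK.
Qed.

(** Any nonzero off-diagonal entry serves as pivot, since permuting the coordinates changes the
    cubic form only by a sign. There remain the diagonal matrices. *)
Lemma noncyclic_derogatory (A : 'M[int]_3) :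
  ~~ cyclicb A -> ~~ is_scalar_mx A -> derogatory A.
Proof.
move=> nc ns; set o : 'I_3 := inord 1.
have H := noncyclic_form nc; rewrite -/o /= in H.
have o0 : o != ord0 by rewrite -val_eqE /= inordK.
have om : o != ord_max by rewrite -val_eqE /= inordK.
have [z1|n1] := eqVneq (A ord0 o) 0; last first.
  apply: (@derogatory_of_pivot _ ord0 o ord_max) => // [l||x z hx hz].
  - by case: (ord3P l) => ->; [constructor 2|constructor 1|constructor 3].
  - by rewrite eq_sym.
  - transitivity (- krylov_form (A ord0 ord0) (A ord0 o) (A ord0 ord_max) (A o ord0) (A o o)
      (A o ord_max) (A ord_max ord0) (A ord_max o) (A ord_max ord_max) 0 x z); last by rewrite H.
    rewrite /krylov_form /=; ring.
have [z2|n2] := eqVneq (A ord0 ord_max) 0; last first.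
  apply: (@derogatory_of_pivot _ ord0 ord_max o) => // [l|||x z hx hz].
  - by case: (ord3P l) => ->; [constructor 2|constructor 3|constructor 1].
  - by rewrite eq_sym.
  - by rewrite eq_sym.
  - transitivity (krylov_form (A ord0 ord0) (A ord0 o) (A ord0 ord_max) (A o ord0) (A o o)
      (A o ord_max) (A ord_max ord0) (A ord_max o) (A ord_max ord_max) 0 z x); last by rewrite H.
    rewrite /krylov_form /=; ring.
have [z3|n3] := eqVneq (A o ord0) 0; last first.
  apply: (@derogatory_of_pivot _ o ord0 ord_max) => // [l|x z hx hz].
  - by case: (ord3P l) => ->; [constructor 1|constructor 2|constructor 3].
  - exact: H.
have [z4|n4] := eqVneq (A o ord_max) 0; last first.
  apply: (@derogatory_of_pivot _ o ord_max ord0) => // [l|x z hx hz].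
  - by case: (ord3P l) => ->; [constructor 3|constructor 2|constructor 1].
  - transitivity (- krylov_form (A ord0 ord0) (A ord0 o) (A ord0 ord_max) (A o ord0) (A o o)
      (A o ord_max) (A ord_max ord0) (A ord_max o) (A ord_max ord_max) z 0 x); last by rewrite H.
    rewrite /krylov_form /=; ring.
have [z5|n5] := eqVneq (A ord_max ord0) 0; last first.
  apply: (@derogatory_of_pivot _ ord_max ord0 o) => // [l|||x z hx hz].
  - by case: (ord3P l) => ->; [constructor 1|constructor 3|constructor 2].
  - by rewrite eq_sym.
  - by rewrite eq_sym.
  - transitivity (- krylov_form (A ord0 ord0) (A ord0 o) (A ord0 ord_max) (A o ord0) (A o o)
      (A o ord_max) (A ord_max ord0) (A ord_max o) (A ord_max ord_max) x z 0); last by rewrite H.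
    rewrite /krylov_form /=; ring.
have [z6|n6] := eqVneq (A ord_max o) 0; last first.
  apply: (@derogatory_of_pivot _ ord_max o ord0) => // [l||x z hx hz].
  - by case: (ord3P l) => ->; [constructor 3|constructor 1|constructor 2].
  - by rewrite eq_sym.
  - transitivity (krylov_form (A ord0 ord0) (A ord0 o) (A ord0 ord_max) (A o ord0) (A o o)
      (A o ord_max) (A ord_max ord0) (A ord_max o) (A ord_max ord_max) z x 0); last by rewrite H.
    rewrite /krylov_form /=; ring.
have offd l m : l != m -> A l m = 0.
  by case: (ord3P l) => ->; case: (ord3P m) => ->; rewrite ?eqxx.
(* For diagonal [A] the form at (1, 1, 1) is a Vandermonde determinant, so two diagonal entries
   coincide. *)
have Hd : (A o o - A ord0 ord0) * (A ord_max ord_max - A ord0 ord0) * (A ord_max ord_max - A o o) = 0.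
  rewrite -[RHS](H 1 1 1) // z1 z2 z3 z4 z5 z6 /krylov_form /=; ring.
have fin (i j k : 'I_3) : (forall l, [\/ l = i, l = j | l = k]) -> i != j -> i != k -> j != k ->
    A j j = A k k -> derogatory A.
  move=> all3 ij ik jk e; have [eij|nij] := eqVneq (A i i) (A j j).
    case/negP: ns; apply/is_scalar_mxP; exists (A j j); apply/matrixP => l m; rewrite mxE.
    have [<-|/offd //] := eqVneq l m.
    by rewrite mulr1n; case: (all3 l) => ->; rewrite ?eij -?e.
  exists (A j j), ((A i i - A j j) *: delta_mx i 0), (delta_mx 0 i), (delta_mx i 0); split.
  - rewrite -scalemxAl mul_delta_mx; apply/matrixP => l m; rewrite !mxE.
    have [<-|lm] := eqVneq l m; last first.
      have -> : (l == i) && (m == i) = false.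
        by apply/negbTE; apply: contra lm => /andP[/eqP-> /eqP->].
      by rewrite mulr0n add0r offd // mulr0.
    rewrite mulr1n andbb; case: (all3 l) => ->; rewrite ?eqxx /= ?mulr1 1?addrC ?subrK //.
      by rewrite [j == i]eq_sym (negPf ij) mulr0 add0r.
    by rewrite [k == i]eq_sym (negPf ik) mulr0 add0r.
  - apply/eqP => /matrixP/(_ i 0); rewrite !mxE !eqxx mulr1 => /eqP.
    by rewrite subr_eq0 (negPf nij).
  - by rewrite mul_delta_mx; apply/matrixP => l m; rewrite !ord1 !mxE.
move/eqP: Hd; rewrite !mulf_eq0 !subr_eq0 -orbA => /or3P[] /eqP e.
- apply: (fin ord_max o ord0) => // [l|]; last by rewrite eq_sym.
  by case: (ord3P l) => ->; [constructor 3|constructor 2|constructor 1].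
- apply: (fin o ord_max ord0) => // l.
  by case: (ord3P l) => ->; [constructor 3|constructor 1|constructor 2].
- apply: (fin ord0 ord_max o) => // [l||]; try by rewrite eq_sym.
  by case: (ord3P l) => ->; [constructor 1|constructor 3|constructor 2].
Qed.

(** * Integer matrices in a box *)

Definition mxnorm (m n : nat) (X : 'M[int]_(m, n)) : nat :=
  \max_(ij : 'I_m * 'I_n) `|X ij.1 ij.2|%N.

Lemma mxnorm_ge m n (X : 'M[int]_(m, n)) i j : (`|X i j| <= mxnorm X)%N.
Proof. exact: (leq_bigmax (i, j)). Qed.

Lemma mxnorm_le m n (X : 'M[int]_(m, n)) (K : nat) :
  (forall i j, (`|X i j| <= K)%N) -> (mxnorm X <= K)%N.
Proof. by move=> H; apply/bigmax_leqP => -[i j] _; apply: H. Qed.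

Lemma mxnorm_attained m n (X : 'M[int]_(m.+1, n.+1)) :
  exists i j, `|X i j|%N = mxnorm X.
Proof.
have [|[i j] e] := @bigop.eq_bigmax ('I_m.+1 * 'I_n.+1)%type (fun ij => `|X ij.1 ij.2|%N).
  by rewrite card_prod !card_ord.
by exists i, j; rewrite /mxnorm e.
Qed.

Lemma mxnorm_gt0 m n (X : 'M[int]_(m, n)) : (0 < mxnorm X)%N = (X != 0).
Proof.
rewrite lt0n; congr negb; apply/eqP/eqP => [n0|->]; last first.
  by apply/eqP; rewrite -leqn0; apply: mxnorm_le => i j; rewrite mxE.
apply/matrixP => i j; rewrite mxE; apply/eqP.
by rewrite -absz_eq0 -leqn0 -n0 mxnorm_ge.
Qed.

(** The inverse of [entry_val] on [-M, M]; the absolute value and the reduction modulo [2 * M + 1]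
    only make it total. *)
Definition enc (M : nat) (x : int) : 'I_(2 * M + 1) :=
  Ordinal (ltn_pmod `|(x + M%:Z)%R|%N (ltn_addl (2 * M) (ltn0Sn 0))).

Lemma encK M (x : int) : (`|x| <= M)%N -> entry_val (enc M x) = x.
Proof.
move=> xM; have h : (`|(x + M%:Z)%R| < 2 * M + 1)%N by lia.
rewrite /entry_val /enc /= modn_small //; lia.
Qed.

Lemma entry_val_le M (k : 'I_(2 * M + 1)) : (`|entry_val k| <= M)%N.
Proof. by have := ltn_ord k; rewrite /entry_val; lia. Qed.

Lemma entry_val_inj M : injective (@entry_val M).
Proof. by move=> k l; rewrite /entry_val => e; apply/val_inj => /=; lia. Qed.

Lemma to_intmx_inj d M : injective (@to_intmx d M).
Proof.
move=> A B /matrixP e; apply/matrixP => i j.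
by apply: (@entry_val_inj M); have := e i j; rewrite !mxE.
Qed.

Lemma map_entry_val_le M m n (A : 'M['I_(2 * M + 1)]_(m, n)) :
  (mxnorm (map_mx (@entry_val M) A) <= M)%N.
Proof. by apply: mxnorm_le => i j; rewrite mxE entry_val_le. Qed.

Lemma map_encK M m n (X : 'M[int]_(m, n)) :
  (mxnorm X <= M)%N -> map_mx (@entry_val M) (map_mx (enc M) X) = X.
Proof.
move=> h; apply/matrixP => i j; rewrite !mxE encK //.
exact: leq_trans (mxnorm_ge X i j) h.
Qed.

Lemma card_abs_le (M p : nat) : (#|[pred k : 'I_(2 * M + 1) | (`|entry_val k| <= p)%N]| <= 2 * p + 1)%N.
Proof.
rewrite -[X in (_ <= X)%N]card_ord.
apply: (@leq_card_in _ _ (fun k => enc p (entry_val k))) => k l.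
rewrite !inE => hk hl /(congr1 (@entry_val p)); rewrite !encK //; exact: entry_val_inj.
Qed.

Lemma card_abs_eq (M p : nat) : (#|[pred k : 'I_(2 * M + 1) | `|entry_val k|%N == p]| <= 2)%N.
Proof.
rewrite -[X in (_ <= X)%N]card_bool.
apply: (@leq_card_in _ _ (fun k : 'I_(2 * M + 1) => 0 <= entry_val k)) => k l.
by rewrite !inE => /eqP hk /eqP hl e; apply: entry_val_inj; lia.
Qed.

(** Union bound over an index where the maximum is attained: that coordinate takes at most 2 values,
    each other one at most [2 * p + 1]. *)
Lemma card_sphere (I : finType) (M p : nat) :
  (0 < #|I|)%N ->
  (#|[set f : {ffun I -> 'I_(2 * M + 1)} | \max_i `|entry_val (f i)|%N == p]| <= #|I| * (2 * (2 * p + 1) ^ #|I|.-1))%N.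
Proof.
move=> I0; pose F (i j : I) : pred 'I_(2 * M + 1) :=
  if j == i then [pred k | `|entry_val k|%N == p] else [pred k | (`|entry_val k| <= p)%N].
apply: (@leq_trans #|\bigcup_i [set f | f \in family (F i)]|).
  apply/subset_leq_card/subsetP => f; rewrite inE => /eqP ep.
  have [i ei] := bigop.eq_bigmax (fun i => `|entry_val (f i)|%N) I0.
  apply/bigcupP; exists i => //; rewrite inE; apply/familyP => j; rewrite /F.
  case: ifP => [/eqP->|_]; first by rewrite inE -ei ep.
  by rewrite inE -ep (leq_bigmax j).
apply: (@leq_trans (\sum_i #|[set f | f \in family (F i)]|)%N).
  elim/big_rec2: _ => [|i n A _ h]; first by rewrite cards0.
  exact: leq_trans (leq_card_setU _ _) (leq_add _ h).
rewrite -[X in (_ <= X * _)%N]sum1_card big_distrl /=; apply: leq_sum => i _; rewrite mul1n.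
rewrite cardsE card_family foldrE big_map big_enum (bigD1 i) //=; apply: leq_mul.
  by rewrite /F eqxx; exact: card_abs_eq.
apply: (@leq_trans (\prod_(j | j != i) (2 * p + 1))%N).
  by apply: leq_prod => j /negPf ji; rewrite /F ji; exact: card_abs_le.
by rewrite prod_nat_const (cardC1 i).
Qed.

Lemma sum_layers (T : finType) (S : pred T) (nu : T -> nat) (M : nat) (w L : nat -> nat) :
  (forall t, S t -> (0 < nu t <= M)%N) ->
  (forall p, (0 < p)%N -> #|[set t | S t & nu t == p]| <= L p)%N ->
  (\sum_(t | S t) w (nu t) <= \sum_(1 <= p < M.+1) L p * w p)%N.
Proof.
move=> hS hL.
apply: (@leq_trans (\sum_(t | S t) \sum_(1 <= p < M.+1) (nu t == p) * w p)%N).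
  apply: leq_sum => t /hS ht.
  rewrite (bigD1_seq (nu t)) ?iota_uniq //= ?eqxx ?mul1n ?leq_addr //.
  by rewrite mem_index_iota ltnS.
rewrite exchange_big /= big_nat [X in (_ <= X)%N]big_nat; apply: leq_sum => p /andP[p0 _].
rewrite -big_distrl /= leq_mul2r; apply/orP; right; apply: leq_trans (hL p p0).
by rewrite -sum1dep_card big_mkcondr /=; apply: leq_sum => t _; case: eqP.
Qed.

Lemma card_mxsphere (M p m n : nat) :
  (#|[set X : 'M['I_(2 * M + 1)]_(m.+1, n.+1) | mxnorm (map_mx (@entry_val M) X) == p]|
    <= m.+1 * n.+1 * (2 * (2 * p + 1) ^ (m.+1 * n.+1).-1))%N.
Proof.
have cI : #|{: 'I_m.+1 * 'I_n.+1}| = (m.+1 * n.+1)%N by rewrite card_prod !card_ord.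
have := @card_sphere ('I_m.+1 * 'I_n.+1)%type M p; rewrite cI => /(_ isT); apply: leq_trans.
pose f (X : 'M['I_(2 * M + 1)]_(m.+1, n.+1)) := [ffun ij : 'I_m.+1 * 'I_n.+1 => X ij.1 ij.2].
have fI : injective f.
  by move=> X Y /ffunP e; apply/matrixP => i j; have := e (i, j); rewrite !ffunE.
rewrite -(card_imset _ fI); apply/subset_leq_card/subsetP => _ /imsetP[X + ->].
by rewrite !inE => /eqP <-; apply/eqP/eq_bigr => ij _; rewrite ffunE !mxE.
Qed.

(** Representatives modulo scalars: two such matrices that differ by a scalar matrix are equal. *)
Definition normalized (M : nat) : {set 'M['I_(2 * M + 1)]_3} :=
  [set A | to_intmx A ord_max ord_max == 0].

Definition corner : pred ('I_3 * 'I_3) := pred1 (ord_max, ord_max).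

(** The eight free entries of a normalized matrix, the source of the exponents 8 and 7 in the counts
    below. *)
Definition noncorner (M : nat) (A : 'M['I_(2 * M + 1)]_3) :
  {ffun {ij : 'I_3 * 'I_3 | ~~ corner ij} -> 'I_(2 * M + 1)} :=
  [ffun ij => A (val ij).1 (val ij).2].

Lemma card_noncorner : #|{: {ij : 'I_3 * 'I_3 | ~~ corner ij}}| = 8%N.
Proof. by rewrite card_sig (cardC1 (ord_max, ord_max)) card_prod !card_ord. Qed.

Lemma noncorner_inj M : {in normalized M &, injective (@noncorner M)}.
Proof.
move=> A B; rewrite !inE => /eqP A0 /eqP B0 /ffunP e; apply/matrixP => i j.
have [/eqP[-> ->]|c] := boolP (corner (i, j)).
  by apply: entry_val_inj; rewrite !mxE in A0 B0; rewrite A0 B0.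
by have := e (Sub (i, j) c); rewrite !ffunE SubK.
Qed.

Lemma card_normalized M : (#|normalized M| <= (2 * M + 1) ^ 8)%N.
Proof.
rewrite -card_noncorner -[X in (X ^ _)%N]card_ord -card_ffun.
apply: leq_card_in; exact: noncorner_inj.
Qed.

Lemma card_normalized_sphere (M p : nat) :
  (#|[set A in normalized M | mxnorm (to_intmx A) == p]|
    <= 8 * (2 * (2 * p + 1) ^ 7))%N.
Proof.
have := @card_sphere {ij : 'I_3 * 'I_3 | ~~ corner ij} M p; rewrite card_noncorner => /(_ isT).
apply: leq_trans.
rewrite -(@card_in_imset _ _ (@noncorner M)); last first.
  move=> A B; rewrite !(inE, in_setI) => /andP[hA _] /andP[hB _]; apply: noncorner_inj; rewrite inE //.
apply/subset_leq_card/subsetP => _ /imsetP[A + ->].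
rewrite !inE => /andP[/eqP A0 /eqP <-]; rewrite eqn_leq; apply/andP; split.
  apply/bigmax_leqP => ij _; rewrite ffunE.
  by have := mxnorm_ge (to_intmx A) (val ij).1 (val ij).2; rewrite mxE.
apply/bigmax_leqP => -[i j] _ /=.
have [/eqP[-> ->]|c] := boolP (corner (i, j)); first by rewrite A0.
apply: leq_trans (leq_bigmax (Sub (i, j) c)).
by rewrite ffunE SubK mxE.
Qed.

(** * Counting commutants *)

(** A nontrivial polynomial relation of degree at most 2 for [A], applied to [u], is a linear
    relation between the columns of [krylov A u]. *)
Lemma krylov_singular (A : 'M[int]_3) (u c : 'cV[int]_3) (k : 'I_3) :
  \sum_(j < 3) c j 0 *: A ^+ j = 0 -> c k 0 != 0 -> \det (krylov A u) = 0.
Proof.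
move=> e ck; have : \adj (krylov A u) *m (krylov A u *m c) = 0.
  by rewrite krylov_mulmx e mul0mx mulmx0.
rewrite mulmxA mul_adj_mx mul_scalar_mx => /matrixP/(_ k 0); rewrite !mxE => /eqP.
by rewrite mulf_eq0 (negPf ck) orbF => /eqP.
Qed.

(* The coordinates e, f maximise the 2 x 2 minors of the plane spanned by A and A^2 modulo
   scalars, so that Cramer's rule expresses every other coordinate with coefficients in [-1, 1]. *)
Lemma commutant_coordinates (A : 'M[int]_3) (u : 'cV[int]_3) :
  A ord_max ord_max = 0 -> \det (krylov A u) != 0 ->
  exists e f : 'I_3 * 'I_3, forall Y : 'M[int]_3, Y ord_max ord_max = 0 ->
    A *m Y = Y *m A -> forall i j, (`|Y i j| <= `|Y e.1 e.2| + `|Y f.1 f.2|)%N.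
Proof.
move=> A0 d0; pose t : int := (A ^+ 2) ord_max ord_max; pose B := A ^+ 2 - t%:M.
have BE k l : B k l = (A ^+ 2) k l - t *+ (k == l).
  by rewrite /B; move: (A ^+ 2) => X; rewrite !mxE.
pose minor (ef : ('I_3 * 'I_3) * ('I_3 * 'I_3)) : int :=
  A ef.1.1 ef.1.2 * B ef.2.1 ef.2.2 - A ef.2.1 ef.2.2 * B ef.1.1 ef.1.2.
pose z : 'I_3 * 'I_3 := (ord0, ord0).
case: (@arg_maxnP _ (z, z) predT (fun ef => `|minor ef|%N) isT) => -[e f] _ mx.
(* If all minors vanished, [A] and [B] would be proportional, and [A] would satisfy a nontrivial
   relation of degree at most 2. *)
have m0 : minor (e, f) != 0.
  apply: contraNneq d0 => m0; apply/eqP.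
  have all0 ef : minor ef = 0 by have := mx ef isT; rewrite m0; lia.
  have [An|] := eqVneq A 0.
    apply: (@krylov_singular _ _ (delta_mx (inord 1) 0) (inord 1)); last by rewrite mxE !eqxx.
    rewrite sum_ord3 !mxE.
    by rewrite inordK // An !expr1 /= expr2 mul0r !scaler0 !addr0 -val_eqE /= inordK // scale0r.
  rewrite -mxnorm_gt0; have [i [j <-]] := mxnorm_attained A; rewrite absz_gt0 => Aij.
  (* Coefficients of the relation [A i j *: B - B i j *: A = 0] written in powers of [A]; its
     entries are minors. *)
  pose c : 'cV[int]_3 :=
    \col_k (if k == ord0 then - (A i j * t) else if k == inord 1 then - B i j else A i j).
  apply: (@krylov_singular _ _ c ord_max); last first.
    by rewrite mxE /= -val_eqE /= inordK.
  have c0 : c ord0 0 = - (A i j * t) by rewrite mxE eqxx.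
  have c1 : c (inord 1) 0 = - B i j by rewrite mxE eqxx -val_eqE /= inordK.
  have c2 : c ord_max 0 = A i j by rewrite mxE /= -val_eqE /= inordK.
  rewrite sum_ord3 c0 c1 c2 inordK // expr0 expr1.
  apply/matrixP => k l; rewrite [RHS]mxE; apply: etrans (all0 ((i, j), (k, l))).
  have addE (X Y : 'M[int]_3) : (X + Y) k l = X k l + Y k l by rewrite mxE.
  have scE (X : 'M[int]_3) y : (y *: X) k l = y * X k l by rewrite mxE.
  have oneE : (1 : 'M[int]_3) k l = (k == l)%:R by rewrite mxE.
  rewrite /minor /= !BE !addE !scE oneE.
  by case: (k == l); case: (i == j); rewrite ?mulr1n ?mulr0n; ring.
exists e, f => Y Y0 cAY i j.
have [c ec] := commutant_cyclic d0 cAY.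
(* The vanishing corner of [Y] fixes the coefficient of the identity, which leaves a combination of
   [A] and [B]. *)
have E k l : \det (krylov A u) * Y k l = c (inord 1) * A k l + c ord_max * B k l.
  have ent m n : \det (krylov A u) * Y m n = c ord0 * (m == n)%:R + c (inord 1) * A m n + c ord_max * (A ^+ 2) m n.
    have := ec; rewrite sum_ord3 inordK // expr0 expr1 /=; move: (A ^+ 2) => X /matrixP/(_ m n).
    by rewrite !mxE.
  have := ent ord_max ord_max; rewrite Y0 A0 eqxx -/t !mulr0 addr0 mulr1 => et.
  have c0 : c ord0 = - (c ord_max * t) by apply/eqP; rewrite -addr_eq0 -et.
  rewrite ent c0 BE; case: (k == l); rewrite ?mulr1n ?mulr0n; ring.
have K : minor (e, f) * Y i j = minor ((i, j), f) * Y e.1 e.2 + minor (e, (i, j)) * Y f.1 f.2.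
  apply: (mulfI d0); rewrite mulrDr ![\det _ * (_ * _)]mulrCA !E /minor /=; ring.
have h1 := mx ((i, j), f) isT; have h2 := mx (e, (i, j)) isT.
have : (`|minor (e, f)| * `|Y i j| <= `|minor (e, f)| * (`|Y e.1 e.2| + `|Y f.1 f.2|))%N.
  rewrite -abszM K mulnDr; apply: leq_trans (_ : _ <= `|(minor ((i, j), f) * Y e.1 e.2)%R| + `|(minor (e, (i, j)) * Y f.1 f.2)%R|)%N _.
    lia.
  by rewrite !abszM leq_add // leq_mul.
by rewrite leq_pmul2l // absz_gt0.
Qed.

Lemma to_intmx_le (M : nat) (A : 'M['I_(2 * M + 1)]_3) i j : (`|to_intmx A i j| <= M)%N.
Proof. by rewrite mxE entry_val_le. Qed.

(* Two elements whose coordinates e and f fall in the same cells of side p / 2 differ by less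
   than p, hence coincide. *)
Lemma card_commutant_cyclic (M p : nat) (A : 'M[int]_3) (u : 'cV[int]_3)
    (S : {set 'M['I_(2 * M + 1)]_3}) :
  A ord_max ord_max = 0 -> \det (krylov A u) != 0 -> (0 < p <= M)%N ->
  (forall B, B \in S -> B \in normalized M /\ A *m to_intmx B = to_intmx B *m A) ->
  (forall Y : 'M[int]_3, Y ord_max ord_max = 0 -> A *m Y = Y *m A -> Y != 0 ->
     (p <= mxnorm Y)%N) ->
  (#|S| <= (8 * (M %/ p)) ^ 2)%N.
Proof.
move=> A0 d0 /andP[p0 pM] hS hp; have [e [f H]] := commutant_coordinates A0 d0.
pose cell (x : int) := (`|(x + M%:Z)%R| * 2 %/ p)%N.
(* As [p <= M], one has [M < 2 p (M %/ p)], so [2 |x + M| <= 4 M < 8 p (M %/ p)]. *)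
have cell_lt x : (`|x| <= M)%N -> (cell x < 8 * (M %/ p))%N.
  move=> hx; rewrite /cell ltn_divLR //.
  have h1 : (`|(x + M%:Z)%R| * 2 <= 4 * M)%N by lia.
  have h2 := ltn_ceil M p0; have h3 : (0 < M %/ p)%N by rewrite divn_gt0.
  apply: leq_ltn_trans h1 _; nia.
have cell_eq x y : (`|x| <= M)%N -> (`|y| <= M)%N -> cell x = cell y -> (`|(x - y)%R| * 2 < p)%N.
  move=> hx hy exy; have := divn_eq (`|(x + M%:Z)%R| * 2) p; have := divn_eq (`|(y + M%:Z)%R| * 2) p.
  have := ltn_pmod (`|(x + M%:Z)%R| * 2) p0; have := ltn_pmod (`|(y + M%:Z)%R| * 2) p0.
  rewrite -/(cell x) -/(cell y) exy; lia.
have h0 : (0 < 8 * (M %/ p))%N by rewrite muln_gt0 divn_gt0.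
pose Icell (x : int) : 'I_(8 * (M %/ p)) := Ordinal (ltn_pmod (cell x) h0).
have IcellE x y : (`|x| <= M)%N -> (`|y| <= M)%N -> Icell x = Icell y -> (`|(x - y)%R| * 2 < p)%N.
  move=> hx hy /(congr1 val) /=; rewrite !modn_small ?cell_lt //; exact: cell_eq.
rewrite -[X in (X ^ _)%N]card_ord expnS expn1 -card_prod.
apply: (@leq_card_in _ _ (fun B : 'M['I_(2 * M + 1)]_3 =>
  (Icell (to_intmx B e.1 e.2), Icell (to_intmx B f.1 f.2)))) => B C hB hC eBC.
have E1 := IcellE _ _ (to_intmx_le _ _ _) (to_intmx_le _ _ _) (congr1 fst eBC).
have E2 := IcellE _ _ (to_intmx_le _ _ _) (to_intmx_le _ _ _) (congr1 snd eBC).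
have [nB cB] := hS _ hB; have [nC cC] := hS _ hC.
apply: to_intmx_inj; apply/eqP; rewrite -subr_eq0; apply: contraT => Y0.
set Y := _ - _ in Y0.
have Ye k l : Y k l = to_intmx B k l - to_intmx C k l by rewrite !mxE.
have Ym : Y ord_max ord_max = 0.
  by rewrite Ye; move: nB nC; rewrite !inE => /eqP-> /eqP->; rewrite subrr.
have cY : A *m Y = Y *m A by rewrite mulmxBl mulmxBr cB cC.
have := hp Y Ym cY Y0; have [i [j <-]] := mxnorm_attained Y.
have := H Y Ym cY i j.
rewrite !Ye; lia.
Qed.

(** Each [b] in the commutant has [v] as left and [u] as right eigenvector, with a common eigenvalue
    [mu b]. Thus [b - mu b] is annihilated by both, and if [v 0 i] and [u j 0] are nonzero it is
    determined by the four entries off row [i] and column [j], of size at most [4 M]. The zero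
    corner then recovers [mu b]. *)
Lemma card_commutant_derogatory (M : nat) (A : 'M[int]_3) (S : {set 'M['I_(2 * M + 1)]_3}) :
  derogatory A ->
  (forall B, B \in S -> B \in normalized M /\ A *m to_intmx B = to_intmx B *m A) ->
  (#|S| <= (2 * (4 * M) + 1) ^ 4)%N.
Proof.
move=> [l [u [v [x [eA u0 vx]]]]] hS.
have [j uj] : exists j, u j 0 != 0.
  have := u0; rewrite -mxnorm_gt0; have [j [k <-]] := mxnorm_attained u.
  by rewrite absz_gt0 ord1; exists j.
have [k [i ei]] := mxnorm_attained v; rewrite ord1 {k} in ei.
have vi : v 0 i != 0.
  rewrite -absz_gt0 ei mxnorm_gt0; apply: contraTneq isT => v0.
  by have /matrixP/(_ 0 0) := vx; rewrite v0 mul0mx !mxE.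
pose mu (b : 'M[int]_3) : int := (v *m b *m x) 0 0.
(* Cancelling the scalar [l] leaves [u (v b) = (b u) v]; multiplying by [x] on the right gives
   [b u = mu b *: u]. *)
have key (b : 'M[int]_3) : A *m b = b *m A -> v *m b = mu b *: v /\ b *m u = mu b *: u.
  rewrite eA mulmxDl mulmxDr mul_scalar_mx mul_mx_scalar => /addrI c.
  have c' : u *m (v *m b) = (b *m u) *m v by rewrite !mulmxA c mulmxA.
  have cj : u j 0 * mu b = (b *m u) j 0.
    have := congr1 (fun X => (X *m x) j 0) c'.
    rewrite -[RHS]/(((b *m u) *m v *m x) j 0) -[_ *m v *m x]mulmxA vx mulmx1 => <-.
    by rewrite -mulmxA [in RHS]mxE big_ord1.
  have vb : v *m b = mu b *: v.
    apply/matrixP => r m; rewrite !ord1; apply: (mulfI uj).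
    have /matrixP/(_ j m) := c'; rewrite mxE big_ord1 => ->.
    by rewrite mxE big_ord1 -cj [in RHS]mxE mulrA.
  split=> //; have := congr1 (mulmx^~ x) c'.
  by rewrite vb -[_ *m v *m x]mulmxA vx mulmx1 -mulmxA -scalemxAl vx -scalemxAr mulmx1.
(* Entry [i] of [v b = mu b *: v] is a sum of three products, and [v 0 i] is the largest entry of
   [v] in absolute value. *)
have mule (b : 'M[int]_3) : (forall m n, (`|b m n| <= M)%N) -> A *m b = b *m A -> (`|mu b| <= 3 * M)%N.
  move=> hb /key[/matrixP/(_ 0 i) + _]; rewrite mxE sum_ord3 mxE => E.
  have vi0 : (0 < `|(v 0 i)%R|)%N by rewrite absz_gt0.
  have hv m : (`|(v 0 m)%R| <= `|(v 0 i)%R|)%N by rewrite ei mxnorm_ge.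
  have hvb m : (`|(v 0 m * b m i)%R| <= `|(v 0 i)%R| * M)%N by rewrite abszM leq_mul.
  rewrite -(leq_pmul2r vi0) -abszM -E.
  rewrite -mulnA [(M * _)%N]mulnC; have := hvb ord0; have := hvb (inord 1); have := hvb ord_max.
  move: (_ * M)%N (v 0 ord0 * _) (v 0 (inord 1) * _) (v 0 ord_max * _) => K x0 x1 x2; lia.
pose f (B : 'M['I_(2 * M + 1)]_3) : 'M['I_(2 * (4 * M) + 1)]_2 :=
  \matrix_(a, c) enc (4 * M) ((to_intmx B - (mu (to_intmx B))%:M) (lift i a) (lift j c)).
have <- : #|{: 'M['I_(2 * (4 * M) + 1)]_2}| = ((2 * (4 * M) + 1) ^ 4)%N.
  by rewrite card_mx card_ord.
apply: (@leq_card_in _ _ f) => B C hB hC eBC.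
have [nB cB] := hS _ hB; have [nC cC] := hS _ hC.
set b := to_intmx B in cB; set c := to_intmx C in cC.
have hb m n : (`|b m n| <= M)%N by exact: to_intmx_le.
have hc m n : (`|c m n| <= M)%N by exact: to_intmx_le.
have ent (b' : 'M[int]_3) (y : int) r s : (b' - y%:M) r s = b' r s - y *+ (r == s) by rewrite !mxE.
have bnd (b' : 'M[int]_3) m n : (forall m n, (`|b' m n| <= M)%N) -> (`|mu b'| <= 3 * M)%N ->
    (`|((b' - (mu b')%:M) m n)%R| <= 4 * M)%N.
  move=> h h'; rewrite ent; have := h m n; case: (m == n); rewrite ?mulr1n ?mulr0n; lia.
pose E := (b - (mu b)%:M) - (c - (mu c)%:M).
have EE m n : E m n = (b - (mu b)%:M) m n - (c - (mu c)%:M) m n.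
  by rewrite /E; move: (b - _) (c - _) => X Y; rewrite !mxE.
have Eac a d : E (lift i a) (lift j d) = 0.
  have /matrixP/(_ a d) := eBC; rewrite [LHS]mxE [RHS]mxE => /(congr1 (@entry_val _)).
  rewrite !encK ?bnd ?mule // -/b -/c => e; by rewrite EE e subrr.
have [vb bu] := key _ cB; have [vc cu] := key _ cC.
have vE : v *m E = 0 by rewrite !mulmxBr vb vc !mul_mx_scalar !subrr.
have Eu : E *m u = 0 by rewrite !mulmxBl bu cu !mul_scalar_mx !subrr.
have Eij n : E i (lift j n) = 0.
  have s0 : \sum_(m | m != i) v 0 m * E m (lift j n) = 0.
    by apply: big1 => m; case: (unliftP i m) => [m' ->|->]; rewrite ?eqxx // Eac mulr0.
  apply: (mulfI vi); have /matrixP/(_ 0 (lift j n)) := vE.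
  by rewrite [LHS]mxE [RHS]mxE (bigD1 i) //= s0 addr0 mulr0.
have En m n : E m (lift j n) = 0.
  by case: (unliftP i m) => [m' ->|->].
have Emj m : E m j = 0.
  have s0 : \sum_(n | n != j) E m n * u n 0 = 0.
    by apply: big1 => n; case: (unliftP j n) => [n' ->|->]; rewrite ?eqxx // En mul0r.
  apply: (mulIf uj); have /matrixP/(_ m 0) := Eu.
  by rewrite [LHS]mxE [RHS]mxE (bigD1 j) //= s0 addr0 mul0r.
have E0 m n : E m n = 0 by case: (unliftP j n) => [n' ->|->].
apply: to_intmx_inj; rewrite -/b -/c; apply/matrixP => m n.
move: nB nC; rewrite !inE -/b -/c => /eqP b0 /eqP c0.
have := E0 ord_max ord_max; have := E0 m n.
rewrite !EE !ent eqxx b0 c0.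
case: (m == n); rewrite ?mulr1n ?mulr0n; lia.
Qed.

(** Off the diagonal, [u v] agrees with [A]. If [u] and [v] are both largest at [i], compare with
    another index [k]: the diagonal entries of [u v] at [i] and [k] differ by at most [2 p], and
    their product is that of two off-diagonal entries. *)
Lemma derogatory_norm (A : 'M[int]_3) (l : int) (u : 'cV[int]_3) (v : 'rV[int]_3) :
  A = l%:M + u *m v -> (mxnorm u * mxnorm v <= 3 * mxnorm A)%N.
Proof.
move=> eA; have [i [z <-]] := mxnorm_attained u; have [z' [j <-]] := mxnorm_attained v.
rewrite !ord1 {z z'}; set p := mxnorm A.
have Aij m n : A m n = l *+ (m == n) + u m 0 * v 0 n by rewrite eA !mxE big_ord1.
have off m n : m != n -> (`|(u m 0 * v 0 n)%R| <= p)%N.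
  by move=> /negPf mn; have := mxnorm_ge A m n; rewrite Aij mn mulr0n add0r.
have [<-|/off] := eqVneq i j; last by rewrite abszM; lia.
have [k ik] : exists k, i != k by exists (lift i ord0); rewrite neq_lift.
have ki : k != i by rewrite eq_sym.
have hd : (`|(u i 0 * v 0 i - u k 0 * v 0 k)%R| <= 2 * p)%N.
  have := mxnorm_ge A i i; have := mxnorm_ge A k k; rewrite !Aij !eqxx !mulr1n -/p; lia.
have hp : (`|(u i 0 * v 0 i)%R| * `|(u k 0 * v 0 k)%R| <= p * p)%N.
  have := leq_mul (off _ _ ik) (off _ _ ki); rewrite !abszM; lia.
rewrite -abszM; set x := `|_|%N in hp *; set y := `|_|%N in hp.
have : (x <= y + 2 * p)%N by rewrite /x /y; lia.
(* If [x > 3 p], then [y > p] and [x * y > p * p]. *)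
clear -hp; nia.
Qed.

(** * Sums over shortest vectors *)

(** Comparison along an injection given as a relation, so that no choice of [u] for each [t] is
    needed. *)
Lemma leq_sum_rel (T U : finType) (S : pred T) (V : pred U) (r : T -> U -> bool)
    (F : T -> nat) (G : U -> nat) :
  (forall t, S t -> exists u, [/\ V u, r t u & (F t <= G u)%N]) ->
  (forall t t' u, S t -> S t' -> r t u -> r t' u -> t = t') ->
  (\sum_(t | S t) F t <= \sum_(u | V u) G u)%N.
Proof.
move=> ex inj.
apply: (@leq_trans (\sum_(t | S t) \sum_(u | V u && r t u) G u)%N).
  apply: leq_sum => t /ex[u [Vu tu h]]; rewrite (bigD1 u) ?Vu //=.
  exact: leq_trans h (leq_addr _ _).
rewrite (exchange_big_dep V) /=; last by move=> t u _ /andP[].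
apply: leq_sum => u Vu; rewrite sum_nat_const -[X in (_ <= X)%N]mul1n leq_mul2r; apply/orP; right.
apply/card_le1_eqP => t t'; rewrite !unfold_in Vu /= => /andP[St tu] /andP[St' tu'].
exact: inj tu' tu.
Qed.

Lemma corner0_scalar (A : 'M[int]_3) :
  A ord_max ord_max = 0 -> is_scalar_mx A -> A = 0.
Proof.
move=> A0 /is_scalar_mxP[a eA]; move: A0; rewrite eA mxE eqxx mulr1n => ->.
by rewrite raddf0.
Qed.

Lemma sum_layer_pow (M k : nat) (f : nat -> nat) (c : nat) :
  (forall p, (0 < p <= M)%N -> (f p <= c * M ^ k)%N) ->
  (\sum_(1 <= p < M.+1) f p <= c * M ^ k.+1)%N.
Proof.
move=> h; apply: (@leq_trans (\sum_(1 <= p < M.+1) c * M ^ k)%N).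
  by rewrite big_nat [X in (_ <= X)%N]big_nat; apply: leq_sum => p; rewrite ltnS; exact: h.
by rewrite sum_nat_const_nat subn1 /= expnS mulnCA.
Qed.

(** The left side bounds the number of integer vectors of norm [p] in dimension 3; since
    [2 p + 1 <= 3 p], the constant is 3 * 2 * 9. *)
Lemma sphere3_le (p : nat) : (0 < p)%N -> (3 * (2 * (2 * p + 1) ^ 2) <= 54 * p ^ 2)%N.
Proof. by case: p => // p _; rewrite !expnS !expn0; nia. Qed.

(** There are O(p^7) normalized matrices of norm [p], and [p^7 (M %/ p)^4 <= p^3 M^4 <= M^7] for
    each of the [M] values of [p]. *)
Lemma sum_normalized (M : nat) : 
  (\sum_(A in normalized M | to_intmx A != 0%R) (M %/ mxnorm (to_intmx A)) ^ 4
    <= 8 * (2 * 3 ^ 7) * M ^ 8)%N.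
Proof.
apply: leq_trans (@sum_layers _ (fun A => (A \in normalized M) && (to_intmx A != 0))
  (fun A => mxnorm (to_intmx A)) M (fun p => (M %/ p) ^ 4)%N (fun p => 8 * (2 * (2 * p + 1) ^ 7))%N _ _) _.
- by move=> A /andP[_ nz]; rewrite mxnorm_gt0 nz map_entry_val_le.
- move=> p _; apply: leq_trans (card_normalized_sphere M p).
  by apply/subset_leq_card/subsetP => A; rewrite !inE => /andP[/andP[-> _] ->].
apply: sum_layer_pow => p /andP[p0 pM].
have h1 : ((2 * p + 1) ^ 7 <= 3 ^ 7 * p ^ 7)%N by rewrite -expnMn leq_exp2r //; lia.
have h2 : (p ^ 7 * (M %/ p) ^ 4 <= M ^ 7)%N.
  have -> : (p ^ 7 = p ^ 3 * p ^ 4)%N by rewrite -expnD.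
  rewrite -mulnA -expnMn -[X in (_ <= M ^ X)%N]/(3 + 4)%N expnD leq_mul // leq_exp2r //.
  by rewrite mulnC leq_trunc_div.
move: ((2 * p + 1) ^ 7)%N (p ^ 7)%N ((M %/ p) ^ 4)%N (M ^ 7)%N (3 ^ 7)%N h1 h2 => x y z w t h1 h2.
have : (x * z <= t * w)%N.
  by apply: leq_trans (leq_mul h1 (leqnn z)) _; rewrite -mulnA; apply: leq_mul.
clear; nia.
Qed.

(** For norms [a] and [b] there are O(a^2 b^2) pairs, contributing O(K^2) in total; [(a, b)] takes
    at most [K^2] values. *)
Lemma sum_vector_pairs (K : nat)
    (nu := fun u : 'cV['I_(2 * K + 1)]_3 => mxnorm (map_mx (@entry_val K) u))
    (nv := fun v : 'rV['I_(2 * K + 1)]_3 => mxnorm (map_mx (@entry_val K) v)) :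
  (\sum_(w : 'cV['I_(2 * K + 1)]_3 * 'rV['I_(2 * K + 1)]_3 | (0 < nu w.1) && (0 < nv w.2))
     (K %/ (nu w.1 * nv w.2)) ^ 2 <= 54 ^ 2 * K ^ 4)%N.
Proof.
rewrite -(pair_big (fun u => 0 < nu u)%N (fun v => 0 < nv v)%N
  (fun u v => (K %/ (nu u * nv v)) ^ 2)%N) /=.
have inner a : (\sum_(v | 0 < nv v) (K %/ (a * nv v)) ^ 2 <=
    \sum_(1 <= b < K.+1) 3 * (2 * (2 * b + 1) ^ 2) * (K %/ (a * b)) ^ 2)%N.
  apply: (@sum_layers _ (fun v => 0 < nv v)%N nv K (fun b => (K %/ (a * b)) ^ 2)%N
    (fun b => 3 * (2 * (2 * b + 1) ^ 2))%N) => [v ->|p _]; first exact: map_entry_val_le.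
  apply: leq_trans (@card_mxsphere K p 0 2).
  by apply/subset_leq_card/subsetP => v; rewrite !inE => /andP[].
apply: leq_trans (leq_sum _ (fun u _ => inner (nu u))) _.
apply: leq_trans (@sum_layers _ (fun u => 0 < nu u)%N nu K
    (fun a => \sum_(1 <= b < K.+1) 3 * (2 * (2 * b + 1) ^ 2) * (K %/ (a * b)) ^ 2)%N
    (fun a => 3 * (2 * (2 * a + 1) ^ 2))%N _ _) _.
- by move=> u ->; exact: map_entry_val_le.
- move=> p _; apply: leq_trans (@card_mxsphere K p 2 0).
  by apply/subset_leq_card/subsetP => u; rewrite !inE => /andP[].
apply: sum_layer_pow => a /andP[a0 _]; rewrite big_distrr /=.
apply: sum_layer_pow => b /andP[b0 _].
apply: (@leq_trans (54 * a ^ 2 * (54 * b ^ 2 * (K %/ (a * b)) ^ 2))%N).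
  by rewrite leq_mul ?sphere3_le // leq_mul2r sphere3_le ?orbT.
have -> : (54 * a ^ 2 * (54 * b ^ 2 * (K %/ (a * b)) ^ 2) = 54 ^ 2 * (K %/ (a * b) * (a * b)) ^ 2)%N.
  rewrite !expnMn; move: ((K %/ _) ^ 2)%N (a ^ 2)%N (b ^ 2)%N => x y z; rewrite expnS expn1; nia.
by apply: leq_mul => //; rewrite leq_exp2r // leq_trunc_div.
Qed.

(** The zero corner determines [l] from [u] and [v], so the pair determines [A]. By
    [derogatory_norm], [M / |A| = 3 M / (3 |A|)] is at most [3 M / (|u| |v|)], whence the box of
    size [3 * M]. *)
Lemma sum_derogatory (M : nat) :
  (\sum_(A in normalized M | (to_intmx A != 0%R) && ~~ cyclicb (to_intmx A))
     (M %/ mxnorm (to_intmx A)) ^ 2 <= 54 ^ 2 * 3 ^ 4 * M ^ 4)%N.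
Proof.
rewrite -mulnA -expnMn; apply: leq_trans (sum_vector_pairs (3 * M)).
pose r (A : 'M['I_(2 * M + 1)]_3)
    (w : 'cV['I_(2 * (3 * M) + 1)]_3 * 'rV['I_(2 * (3 * M) + 1)]_3) :=
  let W := map_mx (@entry_val (3 * M)) w.1 *m map_mx (@entry_val (3 * M)) w.2 in
  to_intmx A == (- W ord_max ord_max)%:M + W.
apply: (leq_sum_rel (r := r)); last first.
  by move=> A B w _ _ /eqP eA /eqP eB; apply: to_intmx_inj; rewrite eA eB.
move=> A /andP[]; rewrite inE => /eqP A0 /andP[nz nc].
have ns : ~~ is_scalar_mx (to_intmx A) by apply: contra nz => /(corner0_scalar A0)/eqP.
have [l [u [v [x [eA u0 vx]]]]] := noncyclic_derogatory nc ns.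
have v0 : v != 0.
  by apply: contraTneq isT => v0; have /matrixP/(_ 0 0) := vx; rewrite v0 mul0mx !mxE.
have h := derogatory_norm eA.
have hA : (mxnorm (to_intmx A) <= M)%N by exact: map_entry_val_le.
have pu : (0 < mxnorm u)%N by rewrite mxnorm_gt0.
have pv : (0 < mxnorm v)%N by rewrite mxnorm_gt0.
have uM : (mxnorm u <= 3 * M)%N by apply: leq_trans (leq_trans h _); rewrite ?leq_pmulr // leq_mul2l.
have vM : (mxnorm v <= 3 * M)%N by apply: leq_trans (leq_trans h _); rewrite ?leq_pmull // leq_mul2l.
exists (map_mx (enc (3 * M)) u, map_mx (enc (3 * M)) v); rewrite /r /= !map_encK //; split.
- by rewrite pu.
- rewrite {1}eA; apply/eqP; congr (_%:M + _).
  by move: A0; rewrite eA mxE mxE eqxx mulr1n => /eqP; rewrite addr_eq0 => /eqP.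
- rewrite leq_exp2r //.
  have a0 : (0 < mxnorm (to_intmx A))%N by rewrite mxnorm_gt0.
  rewrite -(@divnMl 3) //; apply: leq_div2l => //; by rewrite muln_gt0 pu.
Qed.

(** * Fibres of the shortest commuting element *)

Definition commutant (M : nat) (A : 'M[int]_3) : {set 'M['I_(2 * M + 1)]_3} :=
  [set B in normalized M | A *m to_intmx B == to_intmx B *m A].

Lemma commutantP (M : nat) (A : 'M[int]_3) B :
  B \in commutant M A -> B \in normalized M /\ A *m to_intmx B = to_intmx B *m A.
Proof. by rewrite inE => /andP[-> /eqP]. Qed.

(** The default [A] is itself a candidate as soon as it is normalized and nonzero. *)
Definition shortest (M : nat) (A : 'M['I_(2 * M + 1)]_3) : 'M['I_(2 * M + 1)]_3 :=
  [arg min_(B < A | (B \in commutant M (to_intmx A)) && (to_intmx B != 0%R))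
     mxnorm (to_intmx B)]%N.

(** The minimum over the box is a minimum over all integer matrices, because anything shorter would
    lie in the box too. *)
Lemma shortestP (M : nat) (A : 'M['I_(2 * M + 1)]_3) :
  A \in normalized M -> to_intmx A != 0 ->
  [/\ shortest A \in normalized M, to_intmx (shortest A) != 0,
      to_intmx A *m to_intmx (shortest A) = to_intmx (shortest A) *m to_intmx A &
      forall Y : 'M[int]_3, Y ord_max ord_max = 0 ->
        to_intmx A *m Y = Y *m to_intmx A -> Y != 0 ->
        (mxnorm (to_intmx (shortest A)) <= mxnorm Y)%N].
Proof.
move=> nA A0; rewrite /shortest; case: arg_minnP => [|B /andP[/commutantP[nB cB] B0] mB].
  by rewrite inE nA eqxx.
split=> // Y Y0 cY Yn; rewrite leqNgt; apply/negP => lt.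
have YM : (mxnorm Y <= M)%N by apply: leq_trans (ltnW lt) _; exact: map_entry_val_le.
have eY : to_intmx (map_mx (enc M) Y) = Y by exact: map_encK.
have := mB (map_mx (enc M) Y); rewrite !inE eY Y0 cY !eqxx Yn => /(_ isT).
by rewrite leqNgt lt.
Qed.

Lemma card_commutant (M : nat) (A : 'M['I_(2 * M + 1)]_3) :
  A \in normalized M -> cyclicb (to_intmx A) -> to_intmx A != 0 ->
  (#|commutant M (to_intmx A)| <= (8 * (M %/ mxnorm (to_intmx (shortest A)))) ^ 2)%N.
Proof.
move=> nA /existsP[u d0] A0; have [nP P0 cP mP] := shortestP nA A0.
apply: (card_commutant_cyclic _ d0) mP; first by move: nA; rewrite inE => /eqP.
  by rewrite mxnorm_gt0 P0; exact: map_entry_val_le.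
exact: commutantP.
Qed.

Lemma normalized_derogatory (M : nat) (A : 'M['I_(2 * M + 1)]_3) :
  A \in normalized M -> to_intmx A != 0 -> ~~ cyclicb (to_intmx A) ->
  derogatory (to_intmx A).
Proof.
rewrite inE => /eqP A0 nz nc; apply: noncyclic_derogatory => //.
by apply: contra nz => /(corner0_scalar A0)/eqP.
Qed.

(** Every [A] in the fibre commutes with [P], so the fibre lies in the commutant of [P]. If [P] is
    cyclic, whatever commutes with [P] commutes with [A], so [P] is also shortest in its own
    commutant. *)
Lemma card_shortest_fiber (M : nat) (P : 'M['I_(2 * M + 1)]_3) :
  P \in normalized M -> to_intmx P != 0 ->
  (#|[set A in normalized M |
      [&& to_intmx A != 0%R, cyclicb (to_intmx A) & shortest A == P]]|
   <= if cyclicb (to_intmx P) then (8 * (M %/ mxnorm (to_intmx P))) ^ 2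
      else (2 * (4 * M) + 1) ^ 4)%N.
Proof.
move=> nP P0; set S := [set A in _ | _].
have hS A : A \in S -> A \in normalized M /\ to_intmx P *m to_intmx A = to_intmx A *m to_intmx P.
  rewrite inE => /and4P[nA A0 _ /eqP eP]; split=> //.
  by have [_ _ + _] := shortestP nA A0; rewrite eP.
case: ifP => [/existsP[u d0]|/negbT nc]; last first.
  exact: card_commutant_derogatory (normalized_derogatory nP P0 nc) hS.
(* A member [A] of the fibre is needed to transfer the minimality of [P]. *)
have [->|[A hA]] := set_0Vmem S; first by rewrite cards0.
apply: (card_commutant_cyclic _ d0 _ hS); first by move: nP; rewrite inE => /eqP.
  by rewrite mxnorm_gt0 P0; exact: map_entry_val_le.
move=> Y Y0 cY Yn; have [_ cA] := hS _ hA; move: hA; rewrite inE => /and4P[nA A0 _ /eqP eP].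
have [_ _ _ /(_ Y Y0)] := shortestP nA A0; rewrite eP; apply => //.
exact: commutant_cyclic_comm d0 cA cY.
Qed.

Lemma sum_commutant : exists C : nat, forall M : nat, (0 < M)%N ->
  (\sum_(A in normalized M) #|commutant M (to_intmx A)| <= C * M ^ 8)%N.
Proof.
have [k3 H3] : exists k, forall M, (0 < M)%N -> ((2 * M + 1) ^ 8 <= k * M ^ 8)%N.
  by exists (3 ^ 8)%N => M M0; rewrite -expnMn leq_exp2r //; lia.
have [k9 H9] : exists k, forall M, (0 < M)%N -> ((2 * (4 * M) + 1) ^ 4 <= k * M ^ 4)%N.
  by exists (9 ^ 4)%N => M M0; rewrite -expnMn leq_exp2r //; lia.
have [k8 H8] : exists k, forall n, ((8 * n) ^ 2 = k * n ^ 2)%N.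
  by exists (8 ^ 2)%N => n; rewrite expnMn.
have [c1 S2] : exists c, forall M, (\sum_(A in normalized M | (to_intmx A != 0%R) &&
    ~~ cyclicb (to_intmx A)) (M %/ mxnorm (to_intmx A)) ^ 2 <= c * M ^ 4)%N.
  by exists (54 ^ 2 * 3 ^ 4)%N => M; exact: sum_derogatory.
have [c2 S1] : exists c, forall M, (\sum_(A in normalized M | to_intmx A != 0%R)
    (M %/ mxnorm (to_intmx A)) ^ 4 <= c * M ^ 8)%N.
  by exists (8 * (2 * 3 ^ 7))%N => M; exact: sum_normalized.
exists (k3 + k9 * c1 + (k8 * k8 * c2 + k9 * (k8 * c1)))%N => M M0.
pose D := @to_intmx 3 M; pose h (A : 'M['I_(2 * M + 1)]_3) := (M %/ mxnorm (D A))%N.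
have {}S1 := S1 M; have {}S2 := S2 M; have M4 := H9 M M0.
have e8 : (M ^ 8 = M ^ 4 * M ^ 4)%N by rewrite -expnD.
have h0 A : D A != 0 -> (0 < h A)%N.
  by move=> A0; rewrite divn_gt0 ?mxnorm_gt0 //; exact: map_entry_val_le.
(* The zero matrix commutes with everything and contributes at most [(2 * M + 1) ^ 8]. *)
rewrite (bigID (fun A => D A == 0)) /= !mulnDl -addnA; apply: leq_add.
  apply: (@leq_trans (\sum_(A in normalized M | D A == 0%R) (2 * M + 1) ^ 8)%N).
    apply: leq_sum => A _; apply: leq_trans (card_normalized M).
    by apply/subset_leq_card/subsetP => B /commutantP[].
  rewrite sum_nat_const; apply: (@leq_trans (1 * (2 * M + 1) ^ 8)%N).
    rewrite leq_mul2r; apply/orP; right; apply/card_le1_eqP => A B; rewrite !unfold_in.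
    by move=> /andP[_ /eqP eA] /andP[_ /eqP eB]; apply: (@to_intmx_inj 3 M); rewrite -/D eA eB.
  by rewrite mul1n; exact: H3.
(* Each derogatory [A] contributes O(M^4). Since [h A >= 1], the sum of [h A ^ 2] in [S2] bounds
   their number by O(M^4). *)
rewrite (bigID (fun A => cyclicb (D A))) /= addnC; apply: leq_add.
  apply: (@leq_trans (\sum_(A in normalized M | (D A != 0%R) && ~~ cyclicb (D A))
    (k9 * M ^ 4) * h A ^ 2)%N).
    rewrite [X in (X <= _)%N](eq_bigl (fun A => (A \in normalized M) && ((D A != 0) && ~~ cyclicb (D A)))); last first.
      by move=> A; rewrite -andbA.
    apply: leq_sum => A /andP[nA /andP[A0 nc]].
    apply: (@leq_trans (k9 * M ^ 4)%N); last by rewrite leq_pmulr // expn_gt0 h0.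
    apply: leq_trans M4; apply: card_commutant_derogatory (normalized_derogatory nA A0 nc) _.
    exact: commutantP.
  rewrite -big_distrr /= e8; have := leq_mul (leqnn (k9 * M ^ 4)%N) S2.
  by move: (\sum_(_ in _ | _) _)%N (M ^ 4)%N => s m; rewrite -!mulnA [(c1 * (m * m))%N]mulnCA.
(* Bound for the total contribution of the cyclic [A] with [shortest A = P]: the size of the fibre
   times the size of each commutant. *)
pose G P := (if cyclicb (D P) then (8 * h P) ^ 2 * (8 * h P) ^ 2
  else k9 * M ^ 4 * (8 * h P) ^ 2)%N.
apply: (@leq_trans (\sum_(P in normalized M | D P != 0%R) G P)%N).
  pose good := fun A => (A \in normalized M) && ((D A != 0) && cyclicb (D A)).
  rewrite [X in (X <= _)%N](eq_bigl good); last by move=> A; rewrite /good -andbA.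
  apply: (@leq_trans (\sum_(A | good A) (8 * h (shortest A)) ^ 2)%N).
    by apply: leq_sum => A /andP[nA /andP[A0 cA]]; exact: card_commutant.
  rewrite (partition_big (@shortest M) (fun P => (P \in normalized M) && (D P != 0))) /=; last first.
    by move=> A /andP[nA /andP[A0 _]]; have [-> -> _ _] := shortestP nA A0.
  apply: leq_sum => P /andP[nP P0].
  rewrite (eq_bigr (fun _ => (8 * h P) ^ 2)%N); last by move=> A /andP[_ /eqP->].
  rewrite sum_nat_const.
  have := card_shortest_fiber nP P0; rewrite -/D.
  set S := [set A in _ | _].
  have -> : #|S| = #|(fun A => good A && (shortest A == P))|.
    by apply: eq_card => A; rewrite inE [RHS]unfold_in /good -!andbA.
  rewrite /G; case: ifP => _ le; apply: leq_mul => //; exact: leq_trans le M4.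
(* Cyclic [P] contribute O(h^4), summed by [S1]; the others O(M^4 h^2), summed by [S2]. *)
apply: (@leq_trans (\sum_(P in normalized M | D P != 0%R) k8 * k8 * h P ^ 4 +
   \sum_(P in normalized M | (D P != 0%R) && ~~ cyclicb (D P)) k9 * M ^ 4 * (k8 * h P ^ 2))%N).
  rewrite (bigID (fun P => cyclicb (D P))) /=; apply: leq_add.
    apply: (@leq_trans (\sum_(P | ((P \in normalized M) && (D P != 0%R)) && cyclicb (D P)) k8 * k8 * h P ^ 4)%N).
      by apply: leq_sum => P /andP[_ cP]; rewrite /G cP H8 mulnACA -expnD.
    by rewrite [X in (_ <= X)%N](bigID (fun P => cyclicb (D P))) /= leq_addr.
  rewrite [X in (X <= _)%N](eq_bigl (fun A => (A \in normalized M) && ((D A != 0) && ~~ cyclicb (D A)))); last first.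
    by move=> A; rewrite -andbA.
  by apply: leq_sum => P /and3P[_ _ /negPf cP]; rewrite /G cP H8.
apply: leq_add.
  by rewrite -big_distrr /= -(mulnA (k8 * k8)%N); apply: leq_mul.
rewrite -!big_distrr /= e8; have := leq_mul (leqnn (k9 * M ^ 4 * k8)%N) S2.
move: (\sum_(_ in _ | _) _)%N (M ^ 4)%N => s m; rewrite -!mulnA.
by rewrite [(c1 * (m * m))%N]mulnCA [(k8 * (m * _))%N]mulnCA.
Qed.

(** * Lower and upper bounds for the number of commuting pairs *)

Lemma commuting_count_ge (N : nat) : (N ^ 10 <= commuting_count 3 N)%N.
Proof.
apply: (@leq_trans #|{: 'M['I_(2 * N + 1)]_3 * 'I_(2 * N + 1)}|).
  rewrite card_prod card_mx card_ord -[X in (N ^ X)%N]/(9 + 1)%N expnD expn1.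
  by rewrite leq_mul ?leq_exp2r //; lia.
pose f (Ak : 'M['I_(2 * N + 1)]_3 * 'I_(2 * N + 1)) :=
  (Ak.1, map_mx (enc N) ((entry_val Ak.2)%:M : 'M[int]_3)).
have fE Ak : to_intmx (f Ak).2 = (entry_val Ak.2)%:M.
  apply: map_encK; apply: mxnorm_le => i j; rewrite mxE.
  by case: (i == j); rewrite ?mulr1n ?mulr0n ?entry_val_le.
have fI : injective f.
  move=> [A k] [B l] e; have eA : A = B := congr1 fst e.
  have := fE (A, k); rewrite e fE /= => /matrixP/(_ ord0 ord0); rewrite !mxE eqxx !mulr1n.
  by move=> /entry_val_inj ->; rewrite eA.
rewrite -cardsT -(card_imset _ fI); apply/subset_leq_card/subsetP => _ /imsetP[Ak _ ->].
by rewrite inE fE /= scalar_mxC.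
Qed.

Lemma comm_mx_shift (X Y : 'M[int]_3) (a b : int) :
  X *m Y = Y *m X -> (X - a%:M) *m (Y - b%:M) = (Y - b%:M) *m (X - a%:M).
Proof.
move=> c; rewrite !mulmxBl !mulmxBr c !mul_scalar_mx !mul_mx_scalar !scale_scalar_mx !opprB.
by rewrite addrACA [RHS]addrACA (mulrC a); congr (_ + _); rewrite addrC.
Qed.

(** Subtracting the corner entry at most doubles the norm, hence the box of size [2 * N]. *)
Definition shift_corner (N : nat) (A : 'M['I_(2 * N + 1)]_3) : 'M['I_(2 * (2 * N) + 1)]_3 :=
  map_mx (enc (2 * N)) (to_intmx A - (to_intmx A ord_max ord_max)%:M).

Lemma to_intmx_shift_corner (N : nat) (A : 'M['I_(2 * N + 1)]_3) :
  to_intmx (shift_corner A) = to_intmx A - (to_intmx A ord_max ord_max)%:M.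
Proof.
apply: map_encK; apply: mxnorm_le => i j; have := to_intmx_le A i j.
have := to_intmx_le A ord_max ord_max; move: (to_intmx A) => X; rewrite !mxE.
move: (X i j) (X ord_max ord_max) => a b hb ha.
by case: (i == j); rewrite ?mulr1n ?mulr0n; lia.
Qed.

(** A pair is recovered from its two shifts and its two corner entries; the latter account for the
    factor [(2 * N + 1) ^ 2]. *)
Lemma commuting_count_le (N : nat) :
  (commuting_count 3 N <=
    (\sum_(A in normalized (2 * N)) #|commutant (2 * N) (to_intmx A)|) * (2 * N + 1) ^ 2)%N.
Proof.
pose Q := [set w : 'M['I_(2 * (2 * N) + 1)]_3 * 'M['I_(2 * (2 * N) + 1)]_3 |
  (w.1 \in normalized (2 * N)) && (w.2 \in commutant (2 * N) (to_intmx w.1))].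
have -> : (\sum_(A in normalized (2 * N)) #|commutant (2 * N) (to_intmx A)|)%N = #|Q|.
  rewrite -sum1dep_card -(pair_big_dep (fun A => A \in normalized (2 * N))
    (fun A B => B \in commutant (2 * N) (to_intmx A)) (fun _ _ => 1%N)) /=.
  by apply: eq_bigr => A _; rewrite sum1_card.
pose f (w : 'M['I_(2 * N + 1)]_3 * 'M['I_(2 * N + 1)]_3) :=
  ((shift_corner w.1, shift_corner w.2), (w.1 ord_max ord_max, w.2 ord_max ord_max)).
have shI (A B : 'M['I_(2 * N + 1)]_3) :
    shift_corner A = shift_corner B -> A ord_max ord_max = B ord_max ord_max -> A = B.
  move=> e e'; apply: to_intmx_inj; have := congr1 (@to_intmx _ _) e.
  rewrite !to_intmx_shift_corner.
  have -> : to_intmx A ord_max ord_max = to_intmx B ord_max ord_max by rewrite !mxE e'.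
  exact: addIr.
have fI : injective f.
  by move=> [A B] [A' B'] [/= e1 e2 e3 e4]; congr (_, _); apply: shI.
have <- : #|{: 'I_(2 * N + 1) * 'I_(2 * N + 1)}| = ((2 * N + 1) ^ 2)%N.
  by rewrite card_prod card_ord expnS expn1.
rewrite -cardsT -cardsX /commuting_count -(card_imset _ fI).
apply/subset_leq_card/subsetP => _ /imsetP[[A B] + ->]; rewrite !inE /= => /eqP cAB.
rewrite !to_intmx_shift_corner andbT.
have c0 (X : 'M[int]_3) : (X - (X ord_max ord_max)%:M) ord_max ord_max == 0.
  by rewrite !mxE eqxx mulr1n subrr.
by rewrite !c0 /=; apply/eqP/comm_mx_shift.
Qed.

Theorem theorem1p1 :
  exists c C : rat, 0 < c /\ 0 < C /\
    forall N : nat, (0 < N)%N ->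
      c * (N%:R) ^+ 10 <= (commuting_count 3 N)%:R /\
      (commuting_count 3 N)%:R <= C * (N%:R) ^+ 10.
Proof.
have [C HC] := sum_commutant.
have [c2 H2] : exists k, forall N, (0 < N)%N -> ((2 * N + 1) ^ 2 <= k * N ^ 2)%N.
  by exists (3 ^ 2)%N => N N0; rewrite -expnMn leq_exp2r //; lia.
have [c8 H8] : exists k, forall N, ((2 * N) ^ 8 = k * N ^ 8)%N.
  by exists (2 ^ 8)%N => N; rewrite expnMn.
(* The successor makes the upper constant positive whatever the values of [C], [c8] and [c2]. *)
exists 1, (C * c8 * c2).+1%:R; split; [by [] | split; [by rewrite ltr0Sn|]] => N N0; split.
  by rewrite mul1r -natrX ler_nat commuting_count_ge.
rewrite -natrX -natrM ler_nat; apply: leq_trans (commuting_count_le N) _.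
have e10 : (N ^ 10 = N ^ 8 * N ^ 2)%N by rewrite -expnD.
have h := HC (2 * N)%N (ltn_mul (isT : 0 < 2)%N N0).
apply: (@leq_trans (C * c8 * c2 * N ^ 10)%N); last by rewrite leq_mul2r leqnSn orbT.
apply: leq_trans (leq_mul h (H2 N N0)) _.
by rewrite H8 e10; move: (N ^ 8)%N (N ^ 2)%N => x y; rewrite !mulnA (mulnAC _ x c2).
Qed.
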